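(* Let $n\ge 2$. Let $(\mathbb{R}^n,\delta)$ be $n$-dimensional Euclidean space and let $(\mathbb{R}^{1+n},\eta)$ be $(1+n)$-dimensional Minkowski spacetime. (1) Suppose that the Killing vector fields of $(\mathbb{R}^n,\delta)$ are defined as induced vector fields by Lie algebra elements, i.e. for each Killing vector field $K$ of $(\mathbb{R}^n,\delta)$ let $V_K\in\mathfrak{aff}(n)$ be such that $V_K^I=K$. Then these elements generate the special Euclidean group: the subgroup of $\mathrm{Aff}(n)$ generated by all $e^{tV_K}$, with $t\in\mathbb{R}$ and $K$ a Killing vector field of $(\mathbb{R}^n,\delta)$, is $SE(n)$. (2) Suppose that the Killing vector fields of $(\mathbb{R}^{1+n},\eta)$ are defined as induced vector fields by Lie algebra elements, i.e. for each Killing vector field $K$ of $(\mathbb{R}^{1+n},\eta)$ let $V_K\in\mathfrak{aff}(1+n)$ be such that $V_K^I=K$. Then these elements generate the Poincaré group: the subgroup of $\mathrm{Aff}(1+n)$ generated by all $e^{tV_K}$, with $t\in\mathbb{R}$ and $K$ a Killing vector field of $(\mathbb{R}^{1+n},\eta)$, is the Poincaré group $\mathcal{P}(1,n)$ (without space and time reversions).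
   Context: Metrics. $\delta$ is the standard Euclidean metric on $\mathbb{R}^n$, with coordinates $x^1,\dots,x^n$. $\eta$ is the constant pseudo-metric $\mathrm{diag}(-1,1,\dots,1)$ on $\mathbb{R}^{1+n}$, with coordinates $x^0,x^1,\dots,x^n$. Killing vector fields. A Killing vector field of a (pseudo-)Riemannian manifold $(M,g)$ is a smooth vector field $K$ on $M$ with $\mathcal{L}_K g=0$. The Killing vector fields of $(\mathbb{R}^n,\delta)$ are the real linear combinations of $\mathcal{J}_{ij}=x^i\partial_j-x^j\partial_i$ and $\mathcal{P}_i=\partial_i$ ($1\le i,j\le n$). The Killing vector fields of $(\mathbb{R}^{1+n},\eta)$ are the real linear combinations of $\mathfrak{K}_i=x^i\partial_0+x^0\partial_i$, $\mathfrak{J}_{ij}=x^i\partial_j-x^j\partial_i$ ($1\le i,j\le n$) and $\mathfrak{P}_\mu=\partial_\mu$ ($0\le\mu\le n$). Induced vector fields. Let $\Sigma:\mathcal{G}\times M\to M$ be an action of a Lie group $\mathcal{G}$ on a manifold $M$. For $V\in T_e\mathcal{G}$, the induced vector field $V^I$ on $M$ is $$V^I|_p=\frac{d}{dt}\Sigma\left(e^{tV},p\right)\Big|_{t=0},\qquad p\in M.$$ The matrix groups and actions used. For $m\ge 1$, identify $\mathbb{R}^m$ with the set of column vectors $(x,1)$, $x\in\mathbb{R}^m$, in $\mathbb{R}^{m+1}$, i.e. add an extra last coordinate equal to $1$ so that translations are realized by matrices. Let $$\mathrm{Aff}(m)=\left\{\begin{pmatrix}R&a\\0&1\end{pmatrix}: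 R\in GL(m,\mathbb{R}),\ a\in\mathbb{R}^m\right\},$$ with Lie algebra $$\mathfrak{aff}(m)=\left\{\begin{pmatrix}A&b\\0&0\end{pmatrix}: A\in M_m(\mathbb{R}),\ b\in\mathbb{R}^m\right\}.$$ The group $\mathrm{Aff}(m)$ acts on $\mathbb{R}^m$ by matrix multiplication on the vectors $(x,1)$, that is, $x\mapsto Rx+a$. Induced vector fields on $\mathbb{R}^m$ are taken with respect to this action, and $e^{tV}$ is the matrix exponential. The isometry groups. $SE(n)\cong SO(n)\rtimes T(n)$ is the subgroup of $\mathrm{Aff}(n)$ of matrices with $R\in SO(n)$ and $a\in\mathbb{R}^n$, where $T(n)$ is the translation group. The Poincaré group $\mathcal{P}(1,n)$, written $\mathcal{R}^{1,n}\rtimes SO(1,n)$ with $\mathcal{R}^{1,n}$ the spacetime translation group, is the subgroup of $\mathrm{Aff}(1+n)$ of matrices with $R\in SO(1,n)$ and $a\in\mathbb{R}^{1+n}$. Here $SO(1,n)$ denotes the group of linear isometries of $\eta$ without space and time reversions, i.e. the identity component of $\{R\in GL(1+n,\mathbb{R}): R^{T}\eta R=\eta\}$. *)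

(* Defs.v *)
From HB Require Import structures.
From mathcomp Require Import all_boot all_order all_algebra.
From mathcomp Require Import all_classical all_reals all_analysis.

Set Implicit Arguments.
Unset Strict Implicit.
Unset Printing Implicit Defensive.

Import Order.TTheory GRing.Theory Num.Theory.
Import numFieldNormedType.Exports.

Local Open Scope classical_set_scope.
Local Open Scope ring_scope.

Definition basis_vec (R : realType) (m : nat) (i : 'I_m) : 'cV[R]_m :=
  delta_mx i 0.

Definition partial (R : realType) (m : nat) (i : 'I_m) (f : 'cV[R]_m -> R) :
    'cV[R]_m -> R :=
  fun x => 'D_(basis_vec R i) f x.

(* Class C^k: all partial derivatives of order at most k exist and are
   continuous. *)
Fixpoint Cn (R : realType) (m : nat) (k : nat) (f : 'cV[R]_m -> R) : Prop :=
  match k with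
  | 0%N => continuous f
  | k'.+1 =>
      [/\ continuous f,
          forall (i : 'I_m) (x : 'cV[R]_m), derivable f x (basis_vec R i)
        & forall i : 'I_m, Cn k' (partial i f)]
  end.

Definition vector_field (R : realType) (m : nat) : Type :=
  'cV[R]_m -> 'cV[R]_m.

Definition component (R : realType) (m : nat) (K : vector_field R m)
    (i : 'I_m) : 'cV[R]_m -> R :=
  fun x => K x i 0.

Definition smooth (R : realType) (m : nat) (K : vector_field R m) : Prop :=
  forall (k : nat) (i : 'I_m), Cn k (component K i).

(* The components of a (pseudo-)metric in the standard coordinates. *)
Definition metric (R : realType) (m : nat) : Type := 'cV[R]_m -> 'M[R]_m.

(* (L_K g)_ij = K^k d_k g_ij + g_kj d_i K^k + g_ik d_j K^k *)
Definition lie_derivative (R : realType) (m : nat) (K : vector_field R m)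
    (g : metric R m) : 'cV[R]_m -> 'M[R]_m :=
  fun x => \matrix_(i, j) \sum_(k < m)
    (component K k x * partial k (fun y => g y i j) x
     + g x k j * partial i (component K k) x
     + g x i k * partial j (component K k) x).

Definition killing (R : realType) (m : nat) (g : metric R m)
    (K : vector_field R m) : Prop :=
  smooth K /\ forall x : 'cV[R]_m, lie_derivative K g x = 0.

Definition eta_mx (R : realType) (n : nat) : 'M[R]_(1 + n) :=
  block_mx (- 1%:M) 0 0 1%:M.

Definition euclidean_metric (R : realType) (n : nat) : metric R n := fun=> 1%:M.
Arguments euclidean_metric : clear implicits.

Definition minkowski_metric (R : realType) (n : nat) : metric R (1 + n) :=
  fun=> eta_mx R n.
Arguments minkowski_metric : clear implicits.

Definition Aff (R : realType) (m : nat) : set 'M[R]_(m + 1) :=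
  [set M | exists (A : 'M[R]_m) (a : 'cV[R]_m),
     A \in unitmx /\ M = block_mx A a 0 1%:M].
Arguments Aff : clear implicits.

Definition aff (R : realType) (m : nat) : set 'M[R]_(m + 1) :=
  [set M | exists (A : 'M[R]_m) (b : 'cV[R]_m), M = block_mx A b 0 0].
Arguments aff : clear implicits.

(* A point x is identified with the column (x, 1), whose last coordinate is
   preserved by Aff m. *)
Definition aff_action (R : realType) (m : nat) (M : 'M[R]_(m + 1))
    (x : 'cV[R]_m) : 'cV[R]_m :=
  usubmx (M *m col_mx x 1%:M).

Definition expmx (R : realType) (p : nat) (A : 'M[R]_p) : 'M[R]_p :=
  limn (series (fun k : nat => (k`!%:R : R)^-1 *: A ^+ k)).

Definition induced_field (R : realType) (m : nat) (V : 'M[R]_(m + 1)) :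
    vector_field R m :=
  fun x => derive1 (fun t : R => aff_action (expmx (t *: V)) x) 0.

(* V K is an element of the Lie algebra inducing K, for each Killing K; the
   values of V at other vector fields are irrelevant. *)
Definition inducing (R : realType) (m : nat) (g : metric R m)
    (V : vector_field R m -> 'M[R]_(m + 1)) : Prop :=
  forall K : vector_field R m, killing g K ->
    aff R m (V K) /\ induced_field (V K) = K.

Definition is_subgroup_of_Aff (R : realType) (m : nat)
    (H : set 'M[R]_(m + 1)) : Prop :=
  [/\ H `<=` Aff R m,
      H 1%:M,
      forall A B, H A -> H B -> H (A *m B)
    & forall A, H A -> H (invmx A)].

Definition generated_subgroup (R : realType) (m : nat)
    (S : set 'M[R]_(m + 1)) : set 'M[R]_(m + 1) :=
  smallest (@is_subgroup_of_Aff R m) S.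

Definition killing_exponentials (R : realType) (m : nat) (g : metric R m)
    (V : vector_field R m -> 'M[R]_(m + 1)) : set 'M[R]_(m + 1) :=
  [set M | exists (t : R) (K : vector_field R m),
     killing g K /\ M = expmx (t *: V K)].

Definition SO (R : realType) (n : nat) : set 'M[R]_n :=
  [set A | A^T *m A = 1%:M /\ \det A = 1].
Arguments SO : clear implicits.

Definition SE (R : realType) (n : nat) : set 'M[R]_(n + 1) :=
  [set M | exists (A : 'M[R]_n) (a : 'cV[R]_n),
     SO R n A /\ M = block_mx A a 0 1%:M].
Arguments SE : clear implicits.

Definition O1 (R : realType) (n : nat) : set 'M[R]_(1 + n) :=
  [set A | A \in unitmx /\ A^T *m eta_mx R n *m A = eta_mx R n].
Arguments O1 : clear implicits.

(* The restricted group, without space and time reversions: smaller than the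
   set of elements of O1 of determinant 1. *)
Definition SO1 (R : realType) (n : nat) : set 'M[R]_(1 + n) :=
  connected_component (O1 R n) 1%:M.
Arguments SO1 : clear implicits.

Definition Poincare (R : realType) (n : nat) : set 'M[R]_((1 + n) + 1) :=
  [set M | exists (A : 'M[R]_(1 + n)) (a : 'cV[R]_(1 + n)),
     SO1 R n A /\ M = block_mx A a 0 1%:M].
Arguments Poincare : clear implicits.

(* Main.v *)
Require Import Defs.
From HB Require Import structures.
From mathcomp Require Import all_boot all_order all_algebra.
From mathcomp Require Import all_classical all_reals all_analysis.
From mathcomp Require Import lra.

Set Implicit Arguments.
Unset Strict Implicit.
Unset Printing Implicit Defensive.

Import Order.TTheory GRing.Theory Num.Theory.
Import numFieldNormedType.Exports.

Local Open Scope classical_set_scope.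
Local Open Scope ring_scope.

(** Fix a constant invertible form [G] on [R^m], and call
    [lie_alg G] the space of matrices [A] with [A^T G + G A = 0].

    Knowing that [V_K] induces [K] pins everything down.  The field induced
    by [block_mx A b 0 0] is [x |-> A x + b], because
    [d/dt expmx (t *: W)] at [0] is [W]; so each [K] is affine, it determines
    [V_K] ([affine_field_inj]), and it is Killing for [G] exactly when [A] is
    in [lie_alg G] ([killing_affine]).  Hence the exponentials under
    study are those of all [block_mx A b 0 0] with [A] in [lie_alg G]
    ([killing_exponentialsE]).  Since
    [expmx (block_mx 0 b 0 0)] is the translation by [b], the generated
    subgroup is the semidirect product of the translations with any group [L]
    of linear maps that contains these [expmx A] and is generated by them
    ([generated_affine_ext]).

    The exponentials stay inside [SO n], resp. the restricted Lorentz group: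
    if [X' = A X] and [Y' = A Y] with [A] in [lie_alg G], then [X^T G Y] is
    constant ([flow_form_cst]); with [X = Y = expmx (t *: A)] this makes
    [expmx A] an isometry, and [t |-> expmx (t *: A)] on [[0, 1]] joins it to
    the identity, which settles the signs ([isom0_det], [isom0_ge1]).

    They generate it: treat both cases at once with the form
    [diag (eps, 1, .., 1)], [eps = 1] or [eps = -1].  The first column of an
    isometry [A] is [(c, s w)] with [w] a unit vector and
    [eps c^2 + s^2 = eps].  In the plane of the first axis and [w], the
    exponentials of [plane_gen eps w] are the rotations or boosts
    [(cos t, sin t)], [(cosh t, sinh t)], and they reach this column as soon
    as [c >= 1] in the Lorentzian case; a connectedness argument gives
    precisely that on the identity component.  Dividing [A] by such an
    exponential leaves an isometry fixing the first axis, that is an element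
    of [SO (n - 1)], resp. [SO n]; an induction on the dimension concludes
    ([SO_gen], [isom0_gen]). *)

(** * Entrywise limits and derivatives of matrices *)

Lemma cvg_mx (R : realType) (m n : nat) (T : Type) (F : set_system T)
    {FF : Filter F} (M : T -> 'M[R]_(m, n)) (L : 'M[R]_(m, n)) :
  (forall i j, (fun x => M x i j) @ F --> L i j) -> M @ F --> L.
Proof.
move=> ML; apply/cvgrPdist_le => /= e e0; near=> x.
rewrite /Num.Def.normr/= mx_normrE (bigmax_le _ (ltW e0))//= => i _.
rewrite !mxE/=; move: i; near: x; apply: filter_forall => /= i.
exact: ((cvgrPdist_le _ _).1 (ML i.1 i.2)).
Unshelve. all: by end_near. Qed.

Lemma cvg_mxE (R : realType) (m n : nat) (T : Type) (F : set_system T)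
    {FF : Filter F} (M : T -> 'M[R]_(m, n)) (L : 'M[R]_(m, n)) i j :
  M @ F --> L -> (fun x => M x i j) @ F --> L i j.
Proof.
move=> ML.
exact: (cvg_comp M (fun N : 'M[R]_(m, n) => N i j) ML
  (@coord_continuous _ _ _ i j L)).
Qed.

Arguments cvg_mxE {R m n T F FF M L} i j _.

Lemma cvg_mulmx (R : realType) (m n p : nat) (T : Type) (F : set_system T)
    {FF : Filter F} (M : T -> 'M[R]_(m, n)) (N : T -> 'M[R]_(n, p))
    (A : 'M[R]_(m, n)) (B : 'M[R]_(n, p)) :
  M @ F --> A -> N @ F --> B -> (fun x => M x *m N x) @ F --> A *m B.
Proof.
move=> MA NB; apply: cvg_mx => i j; rewrite mxE.
under eq_fun do rewrite mxE.
apply: (cvg_big (@add_continuous _)) => k _.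
by apply: cvgM; apply: cvg_mxE.
Qed.

Lemma continuous_mx (R : realType) (m n : nat) (T : topologicalType)
    (M : T -> 'M[R]_(m, n)) :
  (forall i j, continuous (fun x => M x i j)) -> continuous M.
Proof.
move=> cM x.
exact: (@cvg_mx _ _ _ _ _ (nbhs_filter x) M (M x) (fun i j => cM i j x)).
Qed.

Lemma continuous_mulmx (R : realType) (m n p : nat) (T : topologicalType)
    (M : T -> 'M[R]_(m, n)) (N : T -> 'M[R]_(n, p)) :
  continuous M -> continuous N -> continuous (fun x => M x *m N x).
Proof.
move=> cM cN x.
exact: (@cvg_mulmx _ _ _ _ _ _ (nbhs_filter x) M N _ _ (cM x) (cN x)).
Qed.

Lemma is_derive_mx (R : realType) (m n : nat) (X : R -> 'M[R]_(m, n))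
    (t : R) (D : 'M[R]_(m, n)) :
  (forall i j, is_derive t (1 : R) (fun s => X s i j) (D i j)) <->
  is_derive t (1 : R) X D.
Proof.
split=> [H|[dX <-] i j].
  have dX : derivable X t 1 by apply/derivable_mxP => i j; apply: ex_derive.
  apply: DeriveDef => //; rewrite derive_mx//; apply/matrixP => i j.
  by rewrite mxE; apply: derive_val.
apply: DeriveDef; first by move/derivable_mxP : dX.
by rewrite derive_mx// mxE.
Qed.

Lemma is_derive_mulmx (R : realType) (m n p : nat) (X : R -> 'M[R]_(m, n))
    (Y : R -> 'M[R]_(n, p)) (t : R) (DX : 'M[R]_(m, n)) (DY : 'M[R]_(n, p)) :
  is_derive t (1 : R) X DX -> is_derive t (1 : R) Y DY ->
  is_derive t (1 : R) (fun s => X s *m Y s) (DX *m Y t + X t *m DY).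
Proof.
move=> /is_derive_mx dX /is_derive_mx dY; apply/is_derive_mx => i j.
have -> : (fun s => (X s *m Y s) i j) =
    \sum_(k < n) ((fun s => X s i k) * (fun s => Y s k j)).
  by apply/funext => s; rewrite mxE fct_sumE.
have dXY := is_derive_sum (fun k => is_deriveM (dX i k) (dY k j)).
apply: (is_derive_eq dXY); rewrite mxE [in RHS]mxE [X in _ = _ + X]mxE.
rewrite [LHS]big_split/= [LHS]addrC; congr (_ + _); apply: eq_bigr => k _ //.
by rewrite /GRing.scale/= mulrC.
Qed.

Lemma is_derive_trmx (R : realType) (m n : nat) (X : R -> 'M[R]_(m, n))
    (t : R) (D : 'M[R]_(m, n)) :
  is_derive t (1 : R) X D -> is_derive t (1 : R) (fun s => (X s)^T) D^T.
Proof.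
move=> /is_derive_mx dX; apply/is_derive_mx => i j; rewrite mxE.
by under eq_fun do rewrite mxE.
Qed.

Lemma is_derive_mx0_cst (R : realType) (m n : nat) (X : R -> 'M[R]_(m, n))
    (s t : R) :
  (forall u, is_derive u (1 : R) X 0) -> X s = X t.
Proof.
move=> dX; apply/matrixP => i j.
apply: (@is_derive_0_is_cst _ (fun u => X u i j)) => u.
by have /is_derive_mx/(_ i j) := dX u; rewrite mxE.
Qed.

(** * The matrix exponential *)

(** The constant is the sum of all absolute values of the entries of [A]: it
    bounds every row sum, hence the growth of each entry from one power to the
    next. *)
Lemma mxpow_entry_bound (R : realType) (p : nat) (A : 'M[R]_p) :
  exists2 a : R, 0 <= a & forall k i j, `|(A ^+ k) i j| <= a ^+ k.
Proof.
pose a := \sum_i \sum_l `|A i l|.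
have a0 : 0 <= a by apply: sumr_ge0 => i _; apply: sumr_ge0.
exists a => //; elim=> [|k IHk] i j.
  by rewrite expr0 !mxE; case: eqP => _; rewrite ?normr1 ?normr0.
rewrite exprS mxE (le_trans (ler_norm_sum _ _ _))//.
rewrite exprS (@le_trans _ _ ((\sum_l `|A i l|) * a ^+ k))//.
  by rewrite mulr_suml; apply: ler_sum => l _; rewrite normrM ler_wpM2l.
rewrite ler_wpM2r ?exprn_ge0// /a [leRHS](bigD1 i)//= lerDl.
by apply: sumr_ge0 => ? _; apply: sumr_ge0.
Qed.

(** Comparison with the exponential series of [a * `|x|].  The factor [C] makes
    the bound stable under shifting [v], so that the lemma also covers the
    termwise derivatives of the series. *)
Lemma is_cvg_pseries_fact (R : realType) (v : R^nat) (C a x : R) : 0 <= a ->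
  (forall k, `|v k| <= C * a ^+ k) ->
  cvgn (pseries (fun k => k`!%:R^-1 * v k) x).
Proof.
move=> a0 Hv; apply: normed_cvg.
have C0 : 0 <= C by have := Hv 0%N; rewrite expr0 mulr1; apply: le_trans.
apply: (@series_le_cvg _ _ (C \*: exp_coeff (a * `|x|))) => [k|k|k|].
- exact: normr_ge0.
- by rewrite /= mulr_ge0// exp_coeff_ge0// mulr_ge0.
- have -> : (C \*: exp_coeff (a * `|x|)) k =
      k`!%:R^-1 * (C * a ^+ k) * `|x| ^+ k.
    rewrite /= /exp_coeff /GRing.scale/= exprMn [_ / _]mulrC -!mulrA.
    by rewrite mulrCA.
  rewrite /= !normrM normfV normr_nat normrX ler_wpM2r ?exprn_ge0//.
  by rewrite ler_wpM2l ?invr_ge0.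
- apply: is_cvg_seriesZ; exact: is_cvg_series_exp_coeff.
Qed.

Definition expmx_coef (R : realType) (p : nat) (A : 'M[R]_p) i j : R^nat :=
  fun k => k`!%:R^-1 * (A ^+ k) i j.

Definition expmx_sum (R : realType) (p : nat) (A : 'M[R]_p) : nat -> 'M[R]_p :=
  series (fun k : nat => (k`!%:R : R)^-1 *: A ^+ k).

Lemma mxpowZ (R : realType) (p : nat) (A : 'M[R]_p) (t : R) k :
  (t *: A) ^+ k = t ^+ k *: A ^+ k.
Proof.
elim: k => [|k IHk]; first by rewrite !expr0 scale1r.
by rewrite !exprS IHk -!mulmxE -scalemxAl -scalemxAr scalerA.
Qed.

Lemma expmx_series_entry (R : realType) (p : nat) (A : 'M[R]_p) (t : R) n i j :
  expmx_sum (t *: A) n i j =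
  pseries (expmx_coef A i j) t n.
Proof.
rewrite /expmx_sum/series/= summxE; apply: eq_bigr => k _.
by rewrite /expmx_coef mxpowZ scalerA !mxE mulrAC.
Qed.

Lemma is_cvg_expmx_coef (R : realType) (p : nat) (A : 'M[R]_p) (t : R) i j :
  cvgn (pseries (expmx_coef A i j) t).
Proof.
have [a a0 Ha] := mxpow_entry_bound A.
by apply: (@is_cvg_pseries_fact _ _ 1 a) => // k; rewrite mul1r.
Qed.

Lemma cvg_expmx (R : realType) (p : nat) (A : 'M[R]_p) :
  expmx_sum A @ \oo --> expmx A.
Proof.
suff : cvgn (expmx_sum A) by [].
apply/cvg_ex; exists (\matrix_(i, j) limn (pseries (expmx_coef A i j) 1)).
apply: cvg_mx => i j; rewrite mxE -{1}[A]scale1r.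
under eq_fun do rewrite expmx_series_entry.
exact: is_cvg_expmx_coef.
Qed.

Arguments cvg_expmx {R p} A.

Lemma expmxE (R : realType) (p : nat) (A : 'M[R]_p) (t : R) i j :
  expmx (t *: A) i j = limn (pseries (expmx_coef A i j) t).
Proof.
have /(cvg_mxE i j) := cvg_expmx (t *: A).
by under eq_fun do rewrite expmx_series_entry; move/cvg_lim => <-.
Qed.

(** Each entry of [expmx (t *: A)] is an everywhere convergent power series in
    [t], so it may be differentiated termwise; the differentiated coefficients
    are the entries of [A *m A ^+ k] over [k`!]. *)
Lemma is_derive_expmx (R : realType) (p : nat) (A : 'M[R]_p) (t : R) :
  is_derive t (1 : R) (fun s => expmx (s *: A)) (A *m expmx (t *: A)).
Proof.
apply/is_derive_mx => i j; under eq_fun do rewrite expmxE.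
have [a a0 Ha] := mxpow_entry_bound A.
have dE (v : R^nat) : pseries_diffs (fun k => k`!%:R^-1 * v k) =
    (fun k => k`!%:R^-1 * v k.+1).
  apply/funext => k; rewrite /pseries_diffs factS natrM invfM.
  by rewrite mulrA mulrA divff ?mul1r ?pnatr_eq0.
have bnd q k : `|(A ^+ (q + k)) i j| <= a ^+ q * a ^+ k by rewrite -exprD.
have -> : (A *m expmx (t *: A)) i j =
    limn (pseries (pseries_diffs (expmx_coef A i j)) t).
  have L : (fun n => A *m expmx_sum (t *: A) n) @ \oo --> A *m expmx (t *: A).
    by apply: cvg_mulmx; [exact: cvg_cst|exact: cvg_expmx].
  have /cvg_lim <- // : (fun n => (A *m expmx_sum (t *: A) n) i j) @ \oo -->
      (A *m expmx (t *: A)) i j by apply: cvg_mxE.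
  congr (lim (_ @ \oo)); apply/funext => n.
  rewrite [LHS]mxE /pseries/series/= /expmx_coef dE.
  under eq_bigr do rewrite expmx_series_entry /pseries/series/= mulr_sumr.
  rewrite exchange_big/=; apply: eq_bigr => k _.
  rewrite exprS mxE mulr_sumr mulr_suml; apply: eq_bigr => l _.
  by rewrite /expmx_coef -!mulrA mulrCA.
(* any radius beyond [t] works, the series converging everywhere *)
have ltK : `|t| < `| `|t| + 1| by rewrite (ger0_norm (addr_ge0 _ _))// ltrDl.
apply: pseries_snd_diffs ltK; first exact: is_cvg_expmx_coef.
  by rewrite /expmx_coef dE; apply: is_cvg_pseries_fact a0 (bnd 1%N).
by rewrite /expmx_coef !dE; apply: is_cvg_pseries_fact a0 (bnd 2%N).
Qed.

(** Intertwining passes to powers, then to the limit.  Taking for [P] the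
    inclusion of, or projection to, a coordinate block computes exponentials of
    block matrices without expanding their powers. *)
Lemma expmx_intertwine (R : realType) (p q : nat) (A : 'M[R]_p) (B : 'M[R]_q)
    (P : 'M[R]_(p, q)) : A *m P = P *m B -> expmx A *m P = P *m expmx B.
Proof.
move=> AP.
have powP k : (A ^+ k) *m P = P *m (B ^+ k).
  elim: k => [|k IHk]; first by rewrite !expr0 mul1mx mulmx1.
  by rewrite !exprS -!mulmxE -mulmxA IHk !mulmxA AP.
have cvgA : (fun n => expmx_sum A n *m P) @ \oo --> expmx A *m P.
  by apply: cvg_mulmx; [exact: cvg_expmx|exact: cvg_cst].
have cvgB : (fun n => P *m expmx_sum B n) @ \oo --> P *m expmx B.
  by apply: cvg_mulmx; [exact: cvg_cst|exact: cvg_expmx].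
have AB : (fun n => expmx_sum A n *m P) = (fun n => P *m expmx_sum B n).
  apply/funext => n; rewrite /expmx_sum/series/= mulmx_suml mulmx_sumr.
  by apply: eq_bigr => k _; rewrite -scalemxAl -scalemxAr powP.
by rewrite AB in cvgA; apply: cvg_unique cvgA cvgB.
Qed.

Lemma expmx0 (R : realType) (p : nat) : expmx (0 : 'M[R]_p) = 1%:M.
Proof.
apply: (cvg_lim _ (cvg_near_cst _ _)) => //; near=> n.
have n0 : (0 < n)%N by near: n; exact: nbhs_infty_gt.
rewrite /series/= -(prednK n0) big_nat_recl//= expr0 fact0 invr1 scale1r.
by rewrite big1 ?addr0// => k _; rewrite expr0n scaler0.
Unshelve. all: by end_near. Qed.

Lemma expmx_sq0 (R : realType) (p : nat) (A : 'M[R]_p) :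
  A *m A = 0 -> expmx A = 1%:M + A.
Proof.
move=> A2; apply: (cvg_lim _ (cvg_near_cst _ _)) => //; near=> n.
have n1 : (1 < n)%N by near: n; exact: nbhs_infty_gt.
rewrite /series/= -(subnKC n1) big_nat_recl//= big_nat_recl//=.
rewrite expr0 expr1 !invr1 !scale1r big1 ?addr0// => k _.
by rewrite 2!exprS -!mulmxE mulmxA A2 mul0mx scaler0.
Unshelve. all: by end_near. Qed.

(** * Isometries of a constant form and its Lie algebra *)

Definition lie_alg (R : realType) (m : nat) (G : 'M[R]_m) : set 'M[R]_m :=
  [set A | A^T *m G + G *m A = 0].

Definition isom (R : realType) (m : nat) (G : 'M[R]_m) : set 'M[R]_m :=
  [set A | A \in unitmx /\ A^T *m G *m A = G].

Definition isom0 (R : realType) (m : nat) (G : 'M[R]_m) : set 'M[R]_m :=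
  connected_component (isom G) 1%:M.

(** The derivative of [X^T G Y] is [X^T (A^T G + G A) Y = 0].  With [X]
    an exponential, it yields both that [expmx A] is an isometry and, the form
    being invertible, that linear flows are unique. *)
Lemma flow_form_cst (R : realType) (m p q : nat) (G A : 'M[R]_m)
    (X : R -> 'M[R]_(m, p)) (Y : R -> 'M[R]_(m, q)) (t : R) :
  lie_alg G A ->
  (forall s, is_derive s (1 : R) X (A *m X s)) ->
  (forall s, is_derive s (1 : R) Y (A *m Y s)) ->
  (X t)^T *m G *m Y t = (X 0)^T *m G *m Y 0.
Proof.
move=> soA dX dY.
apply: (@is_derive_mx0_cst _ _ _ (fun s => (X s)^T *m G *m Y s)) => u.
have dG : is_derive u (1 : R) (fun=> G) 0 by exact: is_derive_cst.
have := is_derive_mulmx (is_derive_mulmx (is_derive_trmx (dX u)) dG) (dY u).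
rewrite mulmx0 addr0 trmx_mul.
have -> : (X u)^T *m A^T *m G *m Y u + (X u)^T *m G *m (A *m Y u) =
    (X u)^T *m (A^T *m G + G *m A) *m Y u.
  by rewrite mulmxDr mulmxDl !mulmxA.
by rewrite soA mulmx0 mul0mx.
Qed.

Lemma expmx_isom (R : realType) (m : nat) (G A : 'M[R]_m) :
  G \in unitmx -> lie_alg G A -> isom G (expmx A).
Proof.
move=> uG soA.
have EGE : (expmx A)^T *m G *m expmx A = G.
  have := flow_form_cst 1 soA (is_derive_expmx A) (is_derive_expmx A).
  by rewrite scale1r scale0r expmx0 trmx1 mul1mx mulmx1.
split=> //.
have := @mulmx1_unit _ _ (invmx G *m (expmx A)^T *m G) (expmx A).
by case=> //; rewrite -!mulmxA [X in _ *m X]mulmxA EGE mulVmx.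
Qed.

Lemma lie_algZ (R : realType) (m : nat) (G A : 'M[R]_m) (t : R) :
  lie_alg G A -> lie_alg G (t *: A).
Proof.
rewrite /lie_alg/= => soA.
by rewrite linearZ/= -scalemxAl -scalemxAr -scalerDr soA scaler0.
Qed.

(** Both sides of the conclusion have the same product with
    [(expmx (t *: A))^T *m G], by conservation of the form along the two
    solutions, and this matrix is invertible. *)
Lemma expmx_flow (R : realType) (m p : nat) (G A : 'M[R]_m)
    (Y : R -> 'M[R]_(m, p)) (t : R) :
  G \in unitmx -> lie_alg G A ->
  (forall s, is_derive s (1 : R) Y (A *m Y s)) ->
  Y t = expmx (t *: A) *m Y 0.
Proof.
move=> uG soA dY.
have [uE EGE] := expmx_isom uG (lie_algZ t soA).
have := flow_form_cst t soA (is_derive_expmx A) dY.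
rewrite scale0r expmx0 trmx1 mul1mx => H.
have uEG : (expmx (t *: A))^T *m G \in unitmx.
  by rewrite unitmx_mul unitmx_tr uE.
by apply: (can_inj (mulKmx uEG)); rewrite H mulmxA EGE.
Qed.

Lemma isom1 (R : realType) (m : nat) (G : 'M[R]_m) : isom G 1%:M.
Proof. by split; [exact: unitmx1|rewrite trmx1 mul1mx mulmx1]. Qed.

Lemma isomM (R : realType) (m : nat) (G A B : 'M[R]_m) :
  isom G A -> isom G B -> isom G (A *m B).
Proof.
move=> [uA AG] [uB BG]; split; first by rewrite unitmx_mul uA.
by rewrite trmx_mul mulmxA -[X in X *m A]mulmxA -[X in X *m B]mulmxA AG.
Qed.

Lemma isomV (R : realType) (m : nat) (G A : 'M[R]_m) :
  isom G A -> isom G (invmx A).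
Proof.
move=> [uA AG]; split; first by rewrite unitmx_inv.
rewrite -[in LHS]AG !mulmxA trmx_inv mulVmx ?unitmx_tr// mul1mx.
by rewrite -mulmxA mulmxV// mulmx1.
Qed.

(** In contrast to [invmx], the right-hand side is visibly continuous in [A]. *)
Lemma isom_inv (R : realType) (m : nat) (G A : 'M[R]_m) :
  G \in unitmx -> isom G A -> invmx A = invmx G *m A^T *m G.
Proof.
move=> uG [uA AG]; apply: (can_inj (mulmxK uA)).
by rewrite mulVmx// -!mulmxA [X in _ *m X]mulmxA AG mulVmx.
Qed.

(** * The identity component *)

Lemma isom0_sub (R : realType) (m : nat) (G : 'M[R]_m) : isom0 G `<=` isom G.
Proof. exact: connected_component_sub. Qed.

Lemma isom0_image (R : realType) (m : nat) (G : 'M[R]_m)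
    (T : topologicalType) (C : set T) (f : T -> 'M[R]_m) (x y : T) :
  connected C -> continuous f -> C x -> C y ->
  (forall z, C z -> isom G (f z)) -> isom0 G (f x) -> isom0 G (f y).
Proof.
move=> Cc fc Cx Cy fisom /connected_component_trans; apply.
exists (f @` C); last by exists y.
split; [by exists x|by move=> _ [z Cz <-]; exact: fisom|].
by apply: connected_continuous_connected => //; exact: continuous_subspaceT.
Qed.

Lemma isom0_1 (R : realType) (m : nat) (G : 'M[R]_m) : isom0 G 1%:M.
Proof. exact: connected_component_refl (isom1 G). Qed.

(** Left translation by [A] is continuous on the identity component and joins
    [A] to [A *m B]. *)
Lemma isom0M (R : realType) (m : nat) (G A B : 'M[R]_m) :
  isom0 G A -> isom0 G B -> isom0 G (A *m B).
Proof.
move=> GA GB; have cA : continuous (mulmx A : 'M[R]_m -> 'M[R]_m).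
  apply: (@continuous_mulmx _ _ _ _ _ (fun=> A) id).
    exact: cst_continuous.
  by move=> X; exact: cvg_id.
apply: (isom0_image (@component_connected _ _ _) cA (isom0_1 G) GB).
  by move=> Z /isom0_sub; apply: isomM; exact: isom0_sub.
by rewrite mulmx1.
Qed.

Lemma isom0V (R : realType) (m : nat) (G A : 'M[R]_m) :
  G \in unitmx -> isom0 G A -> isom0 G (invmx A).
Proof.
move=> uG GA.
have ct : continuous (fun X : 'M[R]_m => invmx G *m X^T *m G).
  apply: (@continuous_mulmx _ _ _ _ _ (fun X => invmx G *m X^T) (fun=> G)).
    apply: (@continuous_mulmx _ _ _ _ _ (fun=> invmx G) trmx).
      exact: cst_continuous.
    apply: continuous_mx => i j; under eq_fun do rewrite mxE.
    exact: coord_continuous.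
  exact: cst_continuous.
rewrite (isom_inv uG (isom0_sub GA)).
apply: (isom0_image (@component_connected _ _ _) ct (isom0_1 G) GA).
  by move=> Z /isom0_sub GZ; rewrite -isom_inv//; exact: isomV.
by rewrite trmx1 mulmx1 mulVmx//; exact: isom0_1.
Qed.

(** The path [t |-> expmx (t *: A)], for [t] from [0] to [1], stays among the
    isometries. *)
Lemma expmx_isom0 (R : realType) (m : nat) (G A : 'M[R]_m) :
  G \in unitmx -> lie_alg G A -> isom0 G (expmx A).
Proof.
move=> uG soA.
have ce : continuous (fun t : R => expmx (t *: A)).
  move=> t; apply/differentiable_continuous/derivable1_diffP.
  by have [] := is_derive_expmx A t.
have := @isom0_image _ _ G R `[0, 1] (fun t : R => expmx (t *: A)) 0 1.
rewrite scale1r; apply => //.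
- exact: segment_connected.
- by rewrite /= in_itv/= lexx ler01.
- by rewrite /= in_itv/= lexx ler01.
- by move=> z _; apply: expmx_isom => //; exact: lie_algZ.
- by rewrite scale0r expmx0; exact: isom0_1.
Qed.

(** The image of the identity component is an interval that contains [1] and
    avoids the open interval between [-1] and [1]. *)
Lemma isom0_ge1 (R : realType) (m : nat) (G A : 'M[R]_m) (f : 'M[R]_m -> R) :
  continuous f -> (forall B, isom G B -> 1 <= f B ^+ 2) -> f 1%:M = 1 ->
  isom0 G A -> 1 <= f A.
Proof.
move=> cf f1 fI GA; have fA := f1 _ (isom0_sub GA).
rewrite leNgt; apply/negP => fA1.
have fA0 : f A <= 0.
  rewrite leNgt; apply/negP => fA0; move: fA.
  by rewrite leNgt expr_lt1 ?ltW// fA1.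
have : connected (f @` isom0 G).
  apply: connected_continuous_connected; first exact: component_connected.
  exact: continuous_subspaceT.
move=> /connected_intervalP itv.
have imA : (f @` isom0 G) (f A) by exists A.
have im1 : (f @` isom0 G) (f 1%:M) by exists 1%:M => //; exact: isom0_1.
have itv0 : f A <= 0 <= f 1%:M by rewrite fA0 fI ler01.
have [B GB fB0] := itv _ _ imA im1 _ itv0.
by have := f1 _ (isom0_sub GB); rewrite fB0 expr0n/= ler10.
Qed.

Lemma continuous_det (R : realType) (m : nat) :
  continuous (fun A : 'M[R]_m => \det A).
Proof.
apply: (continuous_big (@add_continuous _)) => s _ A.
apply: (@continuousM R _ (fun=> (-1) ^+ perm.odd_perm s)
  (fun B : 'M[R]_m => \prod_i B i (perm.fun_of_perm s i)) A).
  exact: cst_continuous.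
apply: (continuous_big (@mul_continuous _)) => i _; exact: coord_continuous.
Qed.

Lemma isom0_det (R : realType) (m : nat) (G A : 'M[R]_m) :
  G \in unitmx -> isom0 G A -> \det A = 1.
Proof.
move=> uG GA.
have det2 B : isom G B -> \det B ^+ 2 = 1.
  move=> [uB /(congr1 determinant)]; rewrite !det_mulmx det_tr mulrAC -expr2.
  move=> /(congr1 (fun x => x / \det G)).
  by rewrite mulfK ?divff// -unitfE -unitmxE.
have ge1 : 1 <= \det A.
  apply: (isom0_ge1 (@continuous_det R m) _ _ GA); last exact: det1.
  by move=> B /det2 ->.
have /eqP := det2 _ (isom0_sub GA); rewrite sqrf_eq1 => /orP[/eqP//|/eqP dA].
by move: ge1; rewrite dA leNgt (lt_trans (ltrN10 R) ltr01).
Qed.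

(** * Rotations and boosts in a plane through the first axis *)

Definition form_mx (R : realType) (n : nat) (eps : R) : 'M[R]_(1 + n) :=
  block_mx eps%:M 0 0 1%:M.

(** For a unit vector [w], the infinitesimal rotation ([eps = 1]) or boost
    ([eps = -1]) in the plane of the first axis and [w]. *)
Definition plane_gen (R : realType) (n : nat) (eps : R) (w : 'cV[R]_n) :
    'M[R]_(1 + n) :=
  block_mx 0 (- eps *: w^T) w 0.

Definition first_axis (R : realType) (n : nat) : 'cV[R]_(1 + n) :=
  col_mx 1%:M 0.

Lemma form_mx_unit (R : realType) (n : nat) (eps : R) :
  eps ^+ 2 = 1 -> form_mx n eps \in unitmx.
Proof.
move=> e2; rewrite unitmxE det_ublock det_scalar1 det1 mulr1 unitfE.
by apply/eqP => e0; move/eqP: e2; rewrite e0 expr0n/= eq_sym oner_eq0.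
Qed.

Lemma lie_alg_plane_gen (R : realType) (n : nat) (eps : R) (w : 'cV[R]_n) :
  eps ^+ 2 = 1 -> lie_alg (form_mx n eps) (plane_gen eps w).
Proof.
move=> e2; rewrite /lie_alg/= /plane_gen /form_mx tr_block_mx !mulmx_block.
rewrite !(trmx0, mul0mx, mulmx0, add0r, addr0, mul1mx, mulmx1).
rewrite add_block_mx [(_ *: _)^T]linearZ/= trmxK.
rewrite mul_scalar_mx mul_mx_scalar !scalerA.
rewrite mulrN -expr2 e2.
by rewrite !addr0 !scaleN1r addrN addNr block_mx0.
Qed.

(** The curve [C] times the first axis plus [S] times [w] solves the linear
    equation of [plane_gen eps w] with the first axis as initial value, so it is
    the orbit of the first axis by uniqueness.  The pair [(C, S)] is
    [(cos, sin)] for [eps = 1] and [(cosh, sinh)] for [eps = -1]. *)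
Lemma expmx_plane_gen (R : realType) (n : nat) (eps : R) (w : 'cV[R]_n)
    (C S : R -> R) (t : R) :
  eps ^+ 2 = 1 -> w^T *m w = 1%:M ->
  C 0 = 1 -> S 0 = 0 ->
  (forall s, is_derive s (1 : R) C (- eps * S s)) ->
  (forall s, is_derive s (1 : R) S (C s)) ->
  expmx (t *: plane_gen eps w) *m first_axis R n = col_mx (C t)%:M (S t *: w).
Proof.
move=> e2 ww C0 S0 dC dS.
pose Y s : 'cV[R]_(1 + n) := col_mx (C s)%:M (S s *: w).
suff dY s : is_derive s (1 : R) Y (plane_gen eps w *m Y s).
  rewrite -/(Y t).
  rewrite (expmx_flow t (form_mx_unit n e2) (lie_alg_plane_gen w e2) dY).
  by rewrite /Y C0 S0 scale0r.
have -> : plane_gen eps w *m Y s = col_mx (- eps * S s)%:M (C s *: w).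
  rewrite /plane_gen mul_block_col !mul0mx add0r addr0 mul_mx_scalar.
  by rewrite -scalemxAr -scalemxAl ww scalerA scale_scalar_mx mulr1 mulrC.
apply/is_derive_mx => i j; case: (split_ordP i) => k ->; rewrite /Y.
  under eq_fun do rewrite col_mxEu mxE.
  by rewrite col_mxEu mxE !ord1/= !mulr1n; exact: dC.
under eq_fun do rewrite col_mxEd mxE mulrC.
rewrite col_mxEd mxE mulrC.
exact: is_deriveZ.
Qed.

(** Fixing the first axis gives the first column; preserving the form then kills
    the rest of the first row. *)
Lemma isom_stab_first_axis (R : realType) (n : nat) (eps : R)
    (B : 'M[R]_(1 + n)) :
  eps ^+ 2 = 1 -> isom (form_mx n eps) B ->
  B *m first_axis R n = first_axis R n ->
  exists2 D : 'M[R]_n, isom 1%:M D & B = block_mx 1%:M 0 0 D.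
Proof.
move=> e2 [uB BG] Be.
move: Be BG uB; rewrite -[B]submxK.
set a := ulsubmx B; set b := ursubmx B; set c := dlsubmx B; set d := drsubmx B.
rewrite mul_block_col !mulmx1 !mulmx0 !addr0 => /eq_col_mx[-> ->].
rewrite tr_block_mx /form_mx !mulmx_block !trmx1 !trmx0.
rewrite !(mul0mx, mulmx0, add0r, addr0, mul1mx, mulmx1).
move=> /eq_block_mx[_ eb _ dd].
have b0 : b = 0.
  move: eb; rewrite mul_scalar_mx => /(congr1 ( *:%R eps)).
  by rewrite scalerA -expr2 e2 scale1r scaler0.
move: dd; rewrite b0 mulmx0 add0r => dd _.
exists d => //; split; last by rewrite mulmx1.
by have [] := mulmx1_unit dd.
Qed.

(** The positive dimension provides a unit vector when [u = 0]. *)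
Lemma unit_direction (R : realType) (n : nat) (u : 'cV[R]_n.+1) :
  exists (s : R) (w : 'cV[R]_n.+1),
    u = s *: w /\ w^T *m w = 1%:M.
Proof.
have [->|u0] := eqVneq u 0.
  exists 0, (delta_mx ord0 0); split; first by rewrite scale0r.
  rewrite trmx_delta mul_delta_mx; apply/matrixP => i j.
  by rewrite !mxE !ord1.
pose q := \sum_i u i 0 ^+ 2.
have q0 : 0 < q.
  rewrite lt_neqAle sumr_ge0 ?andbT; last by move=> i _; exact: sqr_ge0.
  apply: contra u0 => /eqP/esym/eqP.
  rewrite psumr_eq0 => [/allP u2|i _]; last exact: sqr_ge0.
  apply/eqP/matrixP => i j; rewrite ord1 mxE; apply/eqP.
  by have := u2 i (mem_index_enum _); rewrite sqrf_eq0.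
exists (Num.sqrt q), ((Num.sqrt q)^-1 *: u).
have sq0 : Num.sqrt q != 0 by rewrite gt_eqF// sqrtr_gt0.
split; first by rewrite scalerA divff// scale1r.
rewrite [(_ *: _)^T]linearZ/= -scalemxAl -scalemxAr scalerA.
rewrite -invfM -expr2 sqr_sqrtr ?ltW//.
apply/matrixP => i j; rewrite !mxE !ord1/= -[RHS](mulVf (lt0r_neq0 q0)).
by congr (_ * _); apply: eq_bigr => k _; rewrite mxE expr2.
Qed.

(** The last equation says that the image of the first axis has the same square
    [eps] as the first axis itself. *)
Lemma isom_first_column (R : realType) (n : nat) (eps : R)
    (A : 'M[R]_(1 + n.+1)) :
  isom (form_mx n.+1 eps) A ->
  exists (s : R) (w : 'cV[R]_n.+1),
    [/\ A *m first_axis R n.+1 = col_mx (A 0 0)%:M (s *: w), w^T *m w = 1%:M &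
        eps * A 0 0 ^+ 2 + s ^+ 2 = eps].
Proof.
move=> [_ AG].
have Ae : A *m first_axis R n.+1 = col_mx (A 0 0)%:M (dlsubmx A).
  rewrite -[A in LHS]submxK mul_block_col !mulmx1 !mulmx0 !addr0; congr col_mx.
  apply/matrixP => i j; rewrite !mxE !ord1/= mulr1n.
  congr (A _ _); exact/val_inj.
have [s [w [us ww]]] := unit_direction (dlsubmx A).
rewrite us in Ae; exists s, w; split=> //.
pose e := first_axis R n.+1.
have : e^T *m (A^T *m form_mx n.+1 eps *m A) *m e =
    e^T *m form_mx n.+1 eps *m e by rewrite AG.
have -> : e^T *m (A^T *m form_mx n.+1 eps *m A) *m e =
    (A *m e)^T *m form_mx n.+1 eps *m (A *m e).
  by rewrite trmx_mul !mulmxA.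
rewrite Ae /e /first_axis !tr_col_mx /form_mx !mul_row_block !mul_row_col.
rewrite !(mul0mx, mulmx0, add0r, addr0, mul1mx, mulmx1).
rewrite tr_scalar_mx trmx1 mul1mx -!scalar_mxM [(_ *: _)^T]linearZ/=.
rewrite -scalemxAl -scalemxAr ww.
rewrite !scale_scalar_mx -raddfD/= => /matrixP/(_ 0 0); rewrite !mxE/= !mulr1n.
by rewrite mulr1 !expr2 [A 0 0 * eps]mulrC -mulrA.
Qed.

(** The parametrization hypothesis says that the curve [(C, S)] reaches every
    point of the conic [eps c^2 + s^2 = eps] with first coordinate [A 0 0].  Then
    an exponential maps the first axis to the first column of [A], and its inverse
    times [A] fixes the first axis. *)
Lemma reduce_first_column (R : realType) (n : nat) (eps : R) (C S : R -> R)
    (A : 'M[R]_(1 + n.+1)) :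
  eps ^+ 2 = 1 -> C 0 = 1 -> S 0 = 0 ->
  (forall s, is_derive s (1 : R) C (- eps * S s)) ->
  (forall s, is_derive s (1 : R) S (C s)) ->
  (forall s, eps * A 0 0 ^+ 2 + s ^+ 2 = eps ->
    exists t, C t = A 0 0 /\ S t = s) ->
  isom (form_mx n.+1 eps) A ->
  exists (J : 'M[R]_(1 + n.+1)) (D : 'M[R]_n.+1),
    [/\ lie_alg (form_mx n.+1 eps) J, isom 1%:M D &
        A = expmx J *m block_mx 1%:M 0 0 D].
Proof.
move=> e2 C0 S0 dC dS onto GA; have uG := form_mx_unit n.+1 e2.
have [s [w [Ae ww /onto[t [Ct St]]]]] := isom_first_column GA.
pose J := t *: plane_gen eps w.
have soJ : lie_alg (form_mx n.+1 eps) J.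
  by apply: lie_algZ; exact: lie_alg_plane_gen.
have GE := expmx_isom uG soJ; have [uE _] := GE.
have Ee : expmx J *m first_axis R n.+1 = A *m first_axis R n.+1.
  by rewrite (expmx_plane_gen t e2 ww C0 S0 dC dS) Ae Ct St.
have [||D OD BD] := @isom_stab_first_axis _ _ _ (invmx (expmx J) *m A) e2.
- exact: isomM (isomV GE) GA.
- by rewrite -mulmxA -Ee mulmxA mulVmx// mul1mx.
by exists J, D; split => //; rewrite -BD mulmxA mulmxV// mul1mx.
Qed.

(** * Generation of the orthogonal and restricted Lorentz groups *)

Lemma expmx_diag_block (R : realType) (p q : nat) (A : 'M[R]_p) (D : 'M[R]_q) :
  expmx (block_mx A 0 0 D) = block_mx (expmx A) 0 0 (expmx D).
Proof.
set W := block_mx A 0 0 D.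
have WA : W *m col_mx 1%:M 0 = col_mx 1%:M 0 *m A.
  by rewrite mul_block_col mul_col_mx !(mul0mx, mulmx0, mulmx1, mul1mx, addr0).
have WD : W *m col_mx 0 1%:M = col_mx 0 1%:M *m D.
  by rewrite mul_block_col mul_col_mx !(mul0mx, mulmx0, mulmx1, mul1mx, add0r).
rewrite -[LHS]mulmx1 [X in _ *m X]scalar_mx_block block_mxEh mul_mx_row.
rewrite (expmx_intertwine WA) (expmx_intertwine WD) !mul_col_mx.
by rewrite !(mul0mx, mul1mx) -block_mxEh.
Qed.

Lemma det_block1 (R : realType) (n : nat) (D : 'M[R]_n) :
  \det (block_mx 1%:M 0 0 D : 'M[R]_(1 + n)) = \det D.
Proof. by rewrite det_ublock det1 mul1r. Qed.

Lemma form_mx1 (R : realType) (n : nat) : form_mx n (1 : R) = 1%:M.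
Proof. by rewrite /form_mx -scalar_mx_block. Qed.

Lemma isom1_SO (R : realType) (n : nat) (A : 'M[R]_n) :
  SO R n A <-> isom 1%:M A /\ \det A = 1.
Proof.
rewrite /SO/= /isom/= !mulmx1; split=> [[AA dA]|[[_ AA] dA]]; last by [].
by split=> //; split=> //; rewrite unitmxE dA unitr1.
Qed.

Lemma circle_param (R : realType) (c s : R) :
  c ^+ 2 + s ^+ 2 = 1 -> exists t, cos t = c /\ sin t = s.
Proof.
move=> cs1.
have c1 : -1 <= c <= 1.
  rewrite -ler_norml -(@ler_pXn2r _ 2)// ?nnegrE//.
  by rewrite expr1n real_normK ?num_real// -cs1 lerDl sqr_ge0.
have ca := acosK c1.
have sa : sin (acos c) = `|s|.
  by rewrite sin_acos// -cs1 addrC addKr sqrtr_sqr.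
have [s0|s0] := leP 0 s.
  by exists (acos c); rewrite sa ger0_norm.
by exists (- acos c); rewrite cosN sinN sa ltr0_norm// opprK.
Qed.

(** Generation statements take the form of an inclusion in every such [P], which
    lets the induction on the dimension restrict [P] to a block. *)
Definition mulclosed_exp (R : realType) (m : nat) (G : 'M[R]_m)
    (P : set 'M[R]_m) : Prop :=
  (forall A, lie_alg G A -> P (expmx A)) /\
  (forall A B, P A -> P B -> P (A *m B)).

Lemma mulclosed_exp_stab (R : realType) (n : nat) (eps : R)
    (P : set 'M[R]_(1 + n)) :
  mulclosed_exp (form_mx n eps) P ->
  mulclosed_exp 1%:M [set D : 'M[R]_n | P (block_mx 1%:M 0 0 D)].
Proof.
move=> [Pe PM]; split=> [A soA|A B PA PB] /=; last first.
  have := PM _ _ PA PB.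
  by rewrite mulmx_block !(mul0mx, mulmx0, mulmx1, add0r, addr0).
have := Pe (block_mx 0 0 0 A); rewrite expmx_diag_block expmx0; apply.
rewrite /lie_alg/= tr_block_mx /form_mx !mulmx_block !trmx0.
rewrite !(mul0mx, mulmx0, add0r, addr0) add_block_mx.
by rewrite !addr0 soA block_mx0.
Qed.

(** Induction on the dimension, splitting off the first axis.  Dimension one is
    a separate base case: there is no second direction in which to rotate, and
    the determinant alone forces the identity. *)
Lemma SO_gen (R : realType) (n : nat) (P : set 'M[R]_n) :
  mulclosed_exp 1%:M P -> SO R n `<=` P.
Proof.
elim: n P => [|[|n] IHn] P PP A OA.
- have [Pe _] := PP; rewrite (flatmx0 A) -(flatmx0 (expmx 0)); apply: Pe.
  by rewrite /lie_alg/= trmx0 mul0mx mulmx0 addr0.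
- have [Pe _] := PP; have [_ dA] := OA.
  have -> : A = expmx 0 by rewrite expmx0 [A]mx11_scalar -det_mx11 dA.
  by apply: Pe; rewrite /lie_alg/= trmx0 mul0mx mulmx0 addr0.
have [PE PM] := PP.
have [GA dA] := (isom1_SO A).1 OA.
rewrite -[1%:M](form_mx1 R n.+1) in PP PE GA.
have [] := @reduce_first_column _ n 1 cos sin A _ _ _ _ _ _ GA.
- by rewrite expr1n.
- exact: cos0.
- exact: sin0.
- by move=> s; rewrite mulN1r; exact: is_derive_cos.
- by move=> s; rewrite mul1r; exact: circle_param.
move=> J [D [soJ OD AE]].
rewrite AE; apply: PM; first exact: PE.
apply: (IHn _ (mulclosed_exp_stab PP)); apply/isom1_SO; split=> //.
move: dA; rewrite AE det_mulmx det_block1.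
have G1 := form_mx_unit n.+1 (expr1n R 2).
by rewrite (isom0_det G1 (expmx_isom0 G1 soJ)) mul1r.
Qed.

(** As [(c + s) (c - s) = 1] with [c + s > 0], the parameter is
    [ln (c + s)]. *)
Lemma hyperbola_param (R : realType) (c s : R) : 1 <= c ->
  - c ^+ 2 + s ^+ 2 = -1 ->
  exists t, (expR t + expR (- t)) / 2 = c /\ (expR t - expR (- t)) / 2 = s.
Proof.
move=> c1 cs.
have cs1 : (c + s) * (c - s) = 1.
  by rewrite mulrC -subr_sqr; apply: oppr_inj; rewrite opprB addrC.
have p0 : 0 < c + s.
  rewrite ltNge; apply/negP => p0.
  have : (c + s) * (c - s) <= 0.
    by rewrite mulr_le0_ge0//; lra.
  by rewrite cs1 ler10.
exists (ln (c + s)); rewrite expRN lnK ?posrE//.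
have -> : (c + s)^-1 = c - s by rewrite -[LHS]mulr1 -cs1 mulKf// gt_eqF.
by split; lra.
Qed.

Lemma is_derive_expRN (R : realType) (t : R) :
  is_derive t (1 : R) (fun s => expR (- s)) (- expR (- t)).
Proof.
have := is_derive1_comp (is_derive_expR (- t)) (is_deriveN (is_derive_id t 1)).
by rewrite mulrN1.
Qed.

Lemma is_derive_cosh (R : realType) (t : R) :
  is_derive t (1 : R) (fun s => (expR s + expR (- s)) / 2)
    ((expR t - expR (- t)) / 2).
Proof.
have := is_deriveZ 2^-1 (is_deriveD (is_derive_expR t) (is_derive_expRN t)).
have -> : 2^-1 \*: (expR + (fun s => expR (- s))) =
    (fun s : R => (expR s + expR (- s)) / 2).
  by apply/funext => s; rewrite mulrC.
by rewrite [_ / 2]mulrC.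
Qed.

Lemma is_derive_sinh (R : realType) (t : R) :
  is_derive t (1 : R) (fun s => (expR s - expR (- s)) / 2)
    ((expR t + expR (- t)) / 2).
Proof.
have := is_deriveZ 2^-1 (is_deriveB (is_derive_expR t) (is_derive_expRN t)).
have -> : 2^-1 \*: (expR - (fun s => expR (- s))) =
    (fun s : R => (expR s - expR (- s)) / 2).
  by apply/funext => s; rewrite mulrC.
by rewrite opprK [_ / 2]mulrC.
Qed.

(** On the identity component the first entry is at least [1], so the first
    column lies on the branch of the hyperboloid that boosts reach; the quotient
    is a rotation, its determinant being [1] by connectedness. *)
Lemma isom0_gen (R : realType) (n : nat) (P : set 'M[R]_(1 + n.+1)) :
  mulclosed_exp (form_mx n.+1 (-1)) P -> isom0 (form_mx n.+1 (-1)) `<=` P.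
Proof.
move=> PP A GA; have [PE PM] := PP.
have e2 : (-1 : R) ^+ 2 = 1 by rewrite sqrrN expr1n.
have uG := form_mx_unit n.+1 e2.
have A00 : 1 <= A 0 0.
  apply: (isom0_ge1 (f := fun B => B 0 0) _ _ _ GA).
  - exact: coord_continuous.
  - move=> B /isom_first_column[s [_ [_ _ Bs]]].
    by have := sqr_ge0 s; lra.
  - by rewrite mxE.
have [] := @reduce_first_column _ n (-1) (fun s => (expR s + expR (- s)) / 2)
  (fun s => (expR s - expR (- s)) / 2) A e2 _ _ _ _ _ (isom0_sub GA).
- by rewrite oppr0 expR0 divff.
- by rewrite oppr0 expR0 subrr mul0r.
- by move=> s; rewrite opprK mul1r; exact: is_derive_cosh.
- by move=> s; exact: is_derive_sinh.
- by move=> s; rewrite mulN1r; exact: hyperbola_param.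
move=> J [D [soJ OD AE]].
rewrite AE; apply: PM; first exact: PE.
apply: (SO_gen (mulclosed_exp_stab PP)); apply/isom1_SO; split=> //.
move: (isom0_det uG GA); rewrite AE det_mulmx det_block1.
by rewrite (isom0_det uG (expmx_isom0 uG soJ)) mul1r.
Qed.
(** * Affine Killing fields and the affine group they generate *)

Definition affine_field (R : realType) (m : nat) (A : 'M[R]_m) (b : 'cV[R]_m) :
    vector_field R m :=
  fun x => A *m x + b.

(** The linear part intertwines through the inclusion of the first [m]
    coordinates, and the last row is invariant because that of the generator
    vanishes. *)
Lemma expmx_aff (R : realType) (m : nat) (A : 'M[R]_m) (b : 'cV[R]_m) :
  exists c, expmx (block_mx A b 0 0 : 'M[R]_(m + 1)) =
    block_mx (expmx A) c 0 1%:M.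
Proof.
set W := block_mx A b 0 0; set E := expmx W.
have WA : W *m col_mx 1%:M 0 = col_mx 1%:M 0 *m A.
  by rewrite mul_block_col mul_col_mx !(mul0mx, mulmx0, mulmx1, mul1mx, addr0).
have W0 : (0 : 'M[R]_1) *m row_mx (0 : 'M[R]_(1, m)) 1%:M = row_mx 0 1%:M *m W.
  by rewrite mul_row_block !(mul0mx, mulmx0, addr0) row_mx0.
have := expmx_intertwine W0; have := expmx_intertwine WA.
rewrite expmx0 mul1mx -/E -[E]submxK mul_block_col mul_row_block mul_col_mx.
rewrite !(mul0mx, mulmx0, mulmx1, mul1mx, addr0, add0r).
by move=> /eq_col_mx[-> ->] /eq_row_mx[_ <-]; exists (ursubmx E).
Qed.

Lemma expmx_translation (R : realType) (m : nat) (b : 'cV[R]_m) :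
  expmx (block_mx 0 b 0 0 : 'M[R]_(m + 1)) = block_mx 1%:M b 0 1%:M.
Proof.
rewrite expmx_sq0; last first.
  by rewrite mulmx_block !(mul0mx, mulmx0, addr0) block_mx0.
by rewrite scalar_mx_block add_block_mx !(add0r, addr0).
Qed.

Lemma induced_field_aff (R : realType) (m : nat) (A : 'M[R]_m) (b : 'cV[R]_m) :
  induced_field (block_mx A b 0 0) = affine_field A b.
Proof.
apply/funext => x; rewrite /induced_field derive1E /aff_action /affine_field.
set W := block_mx A b 0 0.
have d1 : is_derive (0 : R) (1 : R)
    (fun t : R => expmx (t *: W) *m col_mx x 1%:M)
    (W *m col_mx x 1%:M).
  have dx : is_derive (0 : R) (1 : R) (fun=> col_mx x 1%:M : 'cV[R]_(m + 1)) 0.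
    exact: is_derive_cst.
  have := is_derive_mulmx (is_derive_expmx W 0) dx.
  by rewrite scale0r expmx0 !mulmx1 mulmx0 addr0.
have d2 : is_derive (0 : R) (1 : R)
    (fun t : R => usubmx (expmx (t *: W) *m col_mx x 1%:M))
    (usubmx (W *m col_mx x 1%:M)).
  apply/is_derive_mx => i j; rewrite mxE; under eq_fun do rewrite mxE.
  by move/is_derive_mx : d1; apply.
rewrite (@derive_val _ _ _ _ _ _ _ d2) mul_block_col col_mxKu.
by rewrite mulmx1.
Qed.

Lemma affine_field_inj (R : realType) (m : nat) (A B : 'M[R]_m)
    (a b : 'cV[R]_m) :
  affine_field A a = affine_field B b -> A = B /\ a = b.
Proof.
move=> AB; have ab : a = b.
  by have := congr1 (@^~ 0) AB; rewrite /affine_field !mulmx0 !add0r.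
split=> //; apply/matrixP => i j.
have := congr1 (@^~ (delta_mx j 0)) AB.
rewrite /affine_field ab => /addIr/matrixP/(_ i 0).
by rewrite -!colE !mxE.
Qed.

Lemma component_affineE (R : realType) (m : nat) (A : 'M[R]_m)
    (b : 'cV[R]_m) k h x v :
  component (affine_field A b) k (h *: v + x) =
  component (affine_field A b) k x + h * (A *m v) k 0.
Proof.
by rewrite /component /affine_field mulmxDr -scalemxAr -addrA addrC !mxE.
Qed.

(** The difference quotient of an affine function is constant in [h != 0]. *)
Lemma is_derive_component_affine (R : realType) (m : nat) (A : 'M[R]_m)
    (b : 'cV[R]_m) (k : 'I_m) (x v : 'cV[R]_m) :
  is_derive x v (component (affine_field A b) k) ((A *m v) k 0).
Proof.
have H : (fun h : R => h^-1 *: (component (affine_field A b) k (h *: v + x)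
    - component (affine_field A b) k x)) @ 0^' --> (A *m v) k 0.
  apply: cvg_near_cst; near=> h.
  rewrite component_affineE addrAC subrr add0r /GRing.scale/= mulKf//.
  by near: h; exact: nbhs_dnbhs_neq.
apply: DeriveDef; first by apply/cvg_ex; exists ((A *m v) k 0).
exact: (cvg_lim _ H).
Unshelve. all: by end_near. Qed.

Lemma partial_component_affine (R : realType) (m : nat) (A : 'M[R]_m)
    (b : 'cV[R]_m) (k i : 'I_m) :
  partial i (component (affine_field A b) k) = fun=> A k i.
Proof.
apply/funext => x; rewrite /partial.
rewrite (@derive_val _ _ _ _ _ _ _ (is_derive_component_affine A b k x _)).
by rewrite /basis_vec -colE mxE.
Qed.

Lemma partial_cst (R : realType) (m : nat) (i : 'I_m) (a : R) :
  partial i (fun=> a) = fun=> 0.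
Proof. by apply/funext => x; rewrite /partial derive_cst. Qed.

Lemma Cn_cst (R : realType) (m k : nat) (a : R) : Cn k (fun _ : 'cV[R]_m => a).
Proof.
elim: k a => [|k IHk] a /=; first exact: cst_continuous.
split; first exact: cst_continuous.
- by move=> i x; exact: derivable_cst.
- by move=> i; rewrite partial_cst.
Qed.

Lemma smooth_affine (R : realType) (m : nat) (A : 'M[R]_m) (b : 'cV[R]_m) :
  smooth (affine_field A b).
Proof.
move=> k i.
have c : continuous (component (affine_field A b) i).
  rewrite /component /affine_field.
  have cA : continuous (fun x : 'cV[R]_m => A *m x).
    apply: (@continuous_mulmx _ _ _ _ _ (fun=> A) id).
      exact: cst_continuous.
    by move=> X; exact: cvg_id.
  have cAb : continuous (fun x : 'cV[R]_m => A *m x + b).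
    by move=> x; apply: continuousD; [exact: cA|exact: cst_continuous].
  move=> x; apply: (@continuous_comp _ _ _ (fun y : 'cV[R]_m => A *m y + b)
    (fun v : 'cV[R]_m => v i 0) x (cAb x)).
  exact: coord_continuous.
case: k => [//|k] /=; split=> //.
  by move=> j x; have [] := is_derive_component_affine A b i x (basis_vec R j).
by move=> j; rewrite partial_component_affine; exact: Cn_cst.
Qed.

(** For a constant metric the Lie derivative along [x |-> A x + b] is the
    constant matrix [A^T G + G A]. *)
Lemma killing_affine (R : realType) (m : nat) (G A : 'M[R]_m) (b : 'cV[R]_m) :
  killing (fun=> G) (affine_field A b) <-> lie_alg G A.
Proof.
have E x : lie_derivative (affine_field A b) (fun=> G) x = A^T *m G + G *m A.
  apply/matrixP => i j; rewrite !mxE -big_split/=; apply: eq_bigr => k _.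
  rewrite partial_cst !partial_component_affine mulr0 add0r.
  by rewrite !mxE [G k j * _]mulrC.
split=> [[_ /(_ 0)]|GA]; first by rewrite E.
by split; [exact: smooth_affine|move=> x; rewrite E].
Qed.

(** A Killing field [K] is affine because [V K] induces it.  Conversely, any
    [block_mx A b 0 0] with [A] in [lie_alg G] induces a Killing field [K], and
    it must be [V K] since an affine field determines its coefficients. *)
Lemma killing_exponentialsE (R : realType) (m : nat) (G : 'M[R]_m)
    (V : vector_field R m -> 'M[R]_(m + 1)) :
  inducing (fun=> G) V ->
  killing_exponentials (fun=> G) V =
  [set M | exists (A : 'M[R]_m) (b : 'cV[R]_m),
     lie_alg G A /\ M = expmx (block_mx A b 0 0)].
Proof.
move=> indV; apply/seteqP; split=> [M [t [K [kK ->]]]|M [A [b [GA ->]]]].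
  have [[A [b VK]]] := indV K kK.
  rewrite VK induced_field_aff => KE.
  exists (t *: A), (t *: b); split; last by rewrite scale_block_mx !scaler0.
  by apply: lie_algZ; apply/(killing_affine G A b); rewrite KE.
exists 1, (affine_field A b).
have kK : killing (fun=> G) (affine_field A b) by apply/killing_affine.
split=> //; have [[B [c VK]]] := indV _ kK.
by rewrite VK induced_field_aff => /affine_field_inj[-> ->]; rewrite scale1r.
Qed.

Definition affine_ext (R : realType) (m : nat) (L : set 'M[R]_m) :
    set 'M[R]_(m + 1) :=
  [set M | exists (A : 'M[R]_m) (a : 'cV[R]_m), L A /\ M = block_mx A a 0 1%:M].

Lemma mulmx_affine (R : realType) (m : nat) (A B : 'M[R]_m) (a b : 'cV[R]_m) :
  block_mx A a 0 1%:M *m block_mx B b 0 1%:M =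
  block_mx (A *m B) (A *m b + a) 0 1%:M.
Proof.
by rewrite mulmx_block !(mul0mx, mulmx0, mulmx1, mul1mx, add0r, addr0).
Qed.

(** An element of [affine_ext L] is a translation times a linear map.  The
    translation is an exponential, and the linear maps belonging to a subgroup
    that contains all the exponentials form a set to which the generation
    hypothesis on [L] applies. *)
Lemma generated_affine_ext (R : realType) (m : nat) (G : 'M[R]_m)
    (L : set 'M[R]_m) (V : vector_field R m -> 'M[R]_(m + 1)) :
  inducing (fun=> G) V ->
  (forall A, L A -> A \in unitmx) ->
  L 1%:M ->
  (forall A B, L A -> L B -> L (A *m B)) ->
  (forall A, L A -> L (invmx A)) ->
  (forall A, lie_alg G A -> L (expmx A)) ->
  (forall P, mulclosed_exp G P -> L `<=` P) ->
  generated_subgroup (killing_exponentials (fun=> G) V) = affine_ext L.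
Proof.
move=> indV Lu L1 LM LV Lexp Lgen.
rewrite /generated_subgroup killing_exponentialsE//.
apply/seteqP; split=> [M|_ [A [a [LA ->]]] H [[HAff H1 HM HV] HS]].
  apply; split; last first.
    move=> _ [A [b [GA ->]]]; have [c ->] := expmx_aff A b.
    by exists (expmx A), c; split=> //; exact: Lexp.
  split.
  - by move=> _ [A [a [/Lu uA ->]]]; exists A, a.
  - by exists 1%:M, 0; split=> //; rewrite -scalar_mx_block.
  - move=> _ _ [A [a [LA ->]]] [B [b [LB ->]]].
    by exists (A *m B), (A *m b + a); split; [exact: LM|rewrite mulmx_affine].
  - move=> _ [A [a [LA ->]]].
    exists (invmx A), (- (invmx A *m a)); split; first exact: LV.
    set Ai := block_mx (invmx A) _ _ _; set N := block_mx A _ _ _.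
    have NAi : N *m Ai = 1%:M.
      rewrite mulmx_affine mulmxV ?Lu// mulmxN mulmxA mulmxV ?Lu// mul1mx addNr.
      by rewrite -scalar_mx_block.
    have [uN _] := mulmx1_unit NAi.
    by rewrite -[LHS]mulmx1 -NAi mulmxA mulVmx// mul1mx.
have -> : block_mx A a 0 1%:M =
    block_mx 1%:M a 0 1%:M *m block_mx A 0 0 1%:M :> 'M[R]_(m + 1).
  by rewrite mulmx_affine mul1mx mulmx0 add0r.
apply: (HM).
  rewrite -expmx_translation; apply: HS; exists 0, a; split=> //.
  by rewrite /lie_alg/= trmx0 mul0mx mulmx0 addr0.
apply: (Lgen [set B | H (block_mx B 0 0 1%:M)]) LA; split=> [B GB|B C HB HC] /=.
  by rewrite -(expmx0 R 1) -expmx_diag_block; apply: HS; exists B, 0.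
by have := HM _ _ HB HC; rewrite mulmx_affine mulmx0 add0r.
Qed.

Lemma eta_mxE (R : realType) (n : nat) : eta_mx R n = form_mx n (-1).
Proof. by rewrite /eta_mx /form_mx raddfN. Qed.

Theorem theorem1 (R : realType) (n : nat) (hn : (2 <= n)%N) :
  (forall V : vector_field R n -> 'M[R]_(n + 1),
     inducing (euclidean_metric R n) V ->
     generated_subgroup (killing_exponentials (euclidean_metric R n) V) = SE R n)
  /\
  (forall V : vector_field R (1 + n) -> 'M[R]_((1 + n) + 1),
     inducing (minkowski_metric R n) V ->
     generated_subgroup (killing_exponentials (minkowski_metric R n) V)
       = Poincare R n).
Proof.
split=> V indV.
  apply: (generated_affine_ext indV).
  - by move=> A /isom1_SO[[]].
  - by apply/isom1_SO; split; [exact: isom1|exact: det1].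
  - move=> A B /isom1_SO[GA dA] /isom1_SO[GB dB]; apply/isom1_SO.
    by split; [exact: isomM|rewrite det_mulmx dA dB mulr1].
  - move=> A /isom1_SO[GA dA]; apply/isom1_SO.
    by split; [exact: isomV|rewrite det_inv dA invr1].
  - move=> A GA; have u1 := unitmx1 R n; apply/isom1_SO.
    by split; [exact: expmx_isom|exact: isom0_det (expmx_isom0 u1 GA)].
  - exact: SO_gen.
case: n hn V indV => [//|n] _ V indV.
have uG : eta_mx R n.+1 \in unitmx.
  by rewrite eta_mxE; apply: form_mx_unit; rewrite sqrrN expr1n.
apply: (generated_affine_ext indV).
- by move=> A /isom0_sub[].
- exact: isom0_1.
- exact: isom0M.
- by move=> A; exact: isom0V.
- by move=> A; exact: expmx_isom0.
- by rewrite eta_mxE => P PP A; rewrite /SO1 /O1 eta_mxE; exact: isom0_gen.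
Qed.
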